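(* The convergence condition $\sigma_{\max}(\mathcal B\bar X)<1$ for the signal-anticipating voltage control is less restrictive than the convergence condition $\sigma_{\max}(\mathcal A X)<1$ for the signal-taking voltage control, i.e., $$\sigma_{\max}(\mathcal B\bar X)<\sigma_{\max}(\mathcal A X),$$ where $\mathcal A=\mathrm{diag}\{\alpha_i\}_{i\in\mathcal N}$, $\mathcal B=\mathrm{diag}\{\beta_i\}_{i\in\mathcal N}$ with $\beta_i=\frac{1}{1/\alpha_i+2X_{ii}}$, and $\bar X$ is the matrix obtained from $X$ by setting its diagonal entries to $0$.
   Context: Network: a rooted tree with node set $\mathcal N\cup\{0\}$, $\mathcal N=\{1,\dots,n\}$, root $0$, and set of lines (edges) $\mathcal L$; each line $(h,k)\in\mathcal L$ has reactance $x_{hk}>0$. $\mathcal L_i\subseteq\mathcal L$ is the set of lines on the unique path from $0$ to $i$. The reactance matrix $X\in\mathbb R^{n\times n}$ is $X_{ij}=\sum_{(h,k)\in\mathcal L_i\cap\mathcal L_j}x_{hk}$; it is symmetric positive definite. For each $i\in\mathcal N$, $\delta_i\ge0$ and $f_i:\mathbb R\to\mathbb R$ is a control function with $f_i(u)=0$ on $[-\delta_i/2,\delta_i/2]$, nonincreasing over $\mathbb R$, strictly decreasing and differentiable on $(-\infty,-\delta_i/2)\cup(\delta_i/2,\infty)$, and $\alpha_i$ is a finite constant with $|f_i'(u)|\le\alpha_i$ wherever $f_i$ is differentiable (so necessarily $\alpha_i>0$). $\sigma_{\max}$ denotes the maximum singular value. The two controls (which only explain the names of the conditions) are: with $\Omega_i$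 a closed interval, $\Delta\tilde v\in\mathbb R^n$ a constant vector, and $C_i(q_i)=-\int_0^{q_i}f_i^{-1}(q)dq$, the signal-taking control is $q_i(t+1)=\arg\min_{q_i\in\Omega_i} C_i(q_i)+q_i(\sum_{j\in\mathcal N}X_{ij}q_j(t)+\Delta\tilde v_i)$ and the signal-anticipating control is $q_i(t+1)=\arg\min_{q_i\in\Omega_i} C_i(q_i)+q_i(X_{ii}q_i+\sum_{j\ne i}X_{ij}q_j(t)+\Delta\tilde v_i)$. *)

(* Defs.v *)
From HB Require Import structures.
From mathcomp Require Import all_boot all_order all_algebra.
From mathcomp Require Import all_classical all_reals all_analysis.
Set Implicit Arguments.
Unset Strict Implicit.
Unset Printing Implicit Defensive.
Import Order.TTheory GRing.Theory Num.Theory.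
Import numFieldNormedType.Exports.
Local Open Scope ring_scope.

(* An undirected graph on T is given by its set L of lines, the line (h, k)
   being the two-element set [set h; k]. *)
Definition simple_graph (T : finType) (L : {set {set T}}) : Prop :=
  forall l, l \in L -> #|l| = 2%N.

Definition adjacent (T : finType) (L : {set {set T}}) : rel T :=
  fun h k => [set h; k]%SET \in L.

(* p lists the nodes of the path after its starting point h. *)
Definition simple_path (T : finType) (L : {set {set T}}) (h k : T)
    (p : seq T) : Prop :=
  [/\ path (adjacent L) h p, last h p = k & uniq (h :: p)].

Definition is_tree (T : finType) (L : {set {set T}}) : Prop :=
  simple_graph L /\ forall h k : T, exists! p : seq T, simple_path L h k p.

Definition path_lines (T : finType) (h : T) (p : seq T) : seq {set T} :=
  pairmap (fun a b => [set a; b]%SET) h p.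

(* The nodes are 'I_n.+1, with root ord0. The non-root nodes 1, ..., n are
   indexed by 'I_n, i : 'I_n standing for the node lift ord0 i, of value i.+1.
   In a tree the path p below is unique. *)
Definition root_lines (n : nat) (L : {set {set 'I_n.+1}}) (i : 'I_n) :
    {set {set 'I_n.+1}} :=
  [set l in L | `[< exists p, simple_path L ord0 (lift ord0 i) p /\
                              l \in path_lines ord0 p >]]%SET.

Definition reactance_mx (R : realType) (n : nat) (L : {set {set 'I_n.+1}})
    (x : {set 'I_n.+1} -> R) : 'M[R]_n :=
  \matrix_(i, j) \sum_(l in (root_lines L i :&: root_lines L j)%SET) x l.

Definition zero_diag (R : realType) (n : nat) (M : 'M[R]_n) : 'M[R]_n :=
  \matrix_(i, j) (if i == j then 0 else M i j).

Definition outside_deadband (R : realType) (delta u : R) : Prop :=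
  u < - (delta / 2) \/ delta / 2 < u.

Definition control_function (R : realType) (delta : R) (f : R -> R) : Prop :=
  [/\ forall u : R, - (delta / 2) <= u <= delta / 2 -> f u = 0,
      forall u v : R, u <= v -> f v <= f u,
      forall u v, outside_deadband delta u -> outside_deadband delta v ->
        u < v -> f v < f u
    & forall u, outside_deadband delta u -> derivable f u 1].

Definition singular_value (R : realType) (m n : nat) (M : 'M[R]_(m, n))
    (s : R) : Prop :=
  0 <= s /\ eigenvalue (M^T *m M) (s ^+ 2).

(* For n > 0 the set of singular values is finite and nonempty (M^T *m M is
   symmetric positive semidefinite), so this supremum is a maximum. *)
Definition sigma_max (R : realType) (m n : nat) (M : 'M[R]_(m, n)) : R :=
  sup (fun s : R => singular_value M s).

(* Main.v *)
Require Import Defs.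
From HB Require Import structures.
From mathcomp Require Import all_boot all_order all_algebra.
From mathcomp Require Import all_classical all_reals all_analysis.
From mathcomp Require Import ring lra.
Set Implicit Arguments.
Unset Strict Implicit.
Unset Printing Implicit Defensive.
Import Order.TTheory GRing.Theory Num.Theory.
Import numFieldNormedType.Exports.
Local Open Scope ring_scope.

(** The matrix [B *m Xbar] is a strictly damped copy of [A *m X], entry by
    entry. A line leaving the root lies on the path to [i], so [X i i > 0], and
    strict monotonicity of [f i] outside the deadband forces [alpha i > 0].
    Hence [beta i = c i * alpha i] with
    [c i = 1 / (1 + 2 * alpha i * X i i) < 1], and with [rho < 1] the largest
    [c i] one gets [0 <= (B *m Xbar) i j <= rho * (A *m X) i j].

    The largest singular value is monotone on such matrices
    ([sigma_max_le_scale]): it is the operator norm for the Euclidean norm,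
    and replacing a vector by its entrywise absolute value keeps its norm and
    can only help the larger nonnegative matrix. Therefore
    [sigma_max (B *m Xbar) <= rho * sigma_max (A *m X)], which is
    [< sigma_max (A *m X)] because [A *m X] is not zero.

    That [sigma_max], a supremum of square roots of eigenvalues, is the operator
    norm rests on the variational characterization of the top eigenvalue of a
    symmetric matrix ([symmetric_top_eigenvalue]), obtained by maximizing the
    quadratic form on the compact unit sphere. *)

(** * Euclidean inner product of row vectors *)

Definition dotr (R : realType) (n : nat) (u v : 'rV[R]_n) : R :=
  (u *m v^T) 0 0.

Section InnerProduct.
Variables (R : realType) (n : nat).
Implicit Types (u v w : 'rV[R]_n) (a : R).

Lemma dotrE u v : dotr u v = \sum_j u 0 j * v 0 j.
Proof. by rewrite /dotr mxE; apply: eq_bigr => j _; rewrite mxE. Qed.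

Lemma dotrC u v : dotr u v = dotr v u.
Proof. by rewrite !dotrE; apply: eq_bigr => j _; rewrite mulrC. Qed.

Lemma dotrDl u v w : dotr (u + v) w = dotr u w + dotr v w.
Proof. by rewrite /dotr mulmxDl mxE. Qed.

Lemma dotrZl a u w : dotr (a *: u) w = a * dotr u w.
Proof. by rewrite /dotr -scalemxAl mxE. Qed.

Lemma dotrDr u v w : dotr w (u + v) = dotr w u + dotr w v.
Proof. by rewrite !(dotrC w) dotrDl. Qed.

Lemma dotrZr a u w : dotr w (a *: u) = a * dotr w u.
Proof. by rewrite !(dotrC w) dotrZl. Qed.

Lemma dotrr_ge0 u : 0 <= dotr u u.
Proof. by rewrite dotrE; apply: sumr_ge0 => j _; rewrite -expr2 sqr_ge0. Qed.

Lemma dotrr_eq0 u : dotr u u = 0 -> u = 0.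
Proof.
rewrite dotrE => /eqP; rewrite psumr_eq0; last first.
  by move=> j _; rewrite -expr2 sqr_ge0.
move=> /allP u0; apply/rowP => j; rewrite mxE; apply/eqP.
by have := u0 j (mem_index_enum _); rewrite mulf_eq0 orbb.
Qed.

Lemma dotrr_gt0 u : u != 0 -> 0 < dotr u u.
Proof.
move=> u0; rewrite lt_neqAle dotrr_ge0 andbT eq_sym.
by apply: contra u0 => /eqP/dotrr_eq0 ->.
Qed.

Lemma sqr_coord_le_dotrr u j : u 0 j ^+ 2 <= dotr u u.
Proof.
rewrite dotrE (bigD1 j) //= -expr2 lerDl.
by apply: sumr_ge0 => k _; rewrite -expr2 sqr_ge0.
Qed.

Lemma dotrr_abs u : dotr (map_mx Num.norm u) (map_mx Num.norm u) = dotr u u.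
Proof.
rewrite !dotrE; apply: eq_bigr => j _.
by rewrite !mxE -normrM ger0_norm // -expr2 sqr_ge0.
Qed.

End InnerProduct.

Lemma dotr_mulmx (R : realType) (m n : nat) (u : 'rV[R]_m) (v : 'rV[R]_n)
  (M : 'M[R]_(m, n)) : dotr (u *m M) v = dotr u (v *m M^T).
Proof. by rewrite /dotr trmx_mul trmxK mulmxA. Qed.

Lemma dotrr_le (R : realType) (n : nat) (u w : 'rV[R]_n) :
  (forall j, `|u 0 j| <= w 0 j) -> dotr u u <= dotr w w.
Proof.
move=> uw; rewrite !dotrE; apply: ler_sum => j _.
rewrite -!expr2 -(real_normK (num_real (u 0 j))).
by rewrite ler_pXn2r ?nnegrE // (le_trans _ (uw j)).
Qed.

(** * The top eigenvalue of a symmetric matrix *)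

Section SymmetricEigenvalue.
Variables (R : realType) (n : nat).
Local Open Scope classical_set_scope.

Lemma continuous_quadratic_form (S : 'M[R]_n) :
  continuous (fun v : 'rV[R]_n => dotr (v *m S) v).
Proof.
rewrite (_ : (fun _ => _) =
  (fun v : 'rV[R]_n => \sum_j (\sum_k v 0 k * S k j) * v 0 j)); last first.
  by apply/funext => w; rewrite dotrE; apply: eq_bigr => j _; rewrite mxE.
apply: continuous_big => [|j _]; first exact: add_continuous.
have cont_row : continuous (fun v : 'rV[R]_n => \sum_k v 0 k * S k j).
  apply: continuous_big => [|k _]; first exact: add_continuous.
  move=> v; apply: (continuousM (s := fun v : 'rV[R]_n => v 0 k)).
    exact: coord_continuous.
  exact: cst_continuous.
move=> v; apply: (continuousM (t := fun v : 'rV[R]_n => v 0 j)).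
  exact: cont_row.
exact: coord_continuous.
Qed.

Lemma compact_unit_sphere : compact [set v : 'rV[R]_n | dotr v v = 1].
Proof.
have cbox : compact [set v : 'rV[R]_n | forall i, v ord0 i \in `[-1, 1]%R].
  by apply: (@rV_compact R n (fun=> `[-1, 1])) => _; exact: segment_compact.
apply: (subclosed_compact _ cbox) => [|v /= v1 i]; last first.
  rewrite /= in_itv /= -ler_norml -(@ler_pXn2r _ 2) ?nnegrE //.
  by rewrite expr1n real_normK ?num_real // -v1 sqr_coord_le_dotrr.
rewrite (_ : [set _ | _] = (fun v => dotr (v *m 1%:M) v) @^-1` [set 1]).
  apply: preimage_closed; last exact: closed_eq.
  by move=> v _; exact: continuous_quadratic_form.
by apply/seteqP; split=> v /=; rewrite mulmx1.
Qed.

(** A zero of a nonnegative quadratic form is a minimum of it, and the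
    gradient at a minimum vanishes. *)
Lemma psd_isotropic_kernel (T : 'M[R]_n) (c : 'rV[R]_n) :
  T^T = T -> (forall v, 0 <= dotr (v *m T) v) -> dotr (c *m T) c = 0 ->
  c *m T = 0.
Proof.
move=> symT T_ge0 Tc0; set w := c *m T; apply: dotrr_eq0.
set b := dotr w w; set q := dotr (w *m T) w.
have q_ge0 : 0 <= q by exact: T_ge0.
have shift t : 0 <= 2 * t * b + t ^+ 2 * q.
  have := T_ge0 (c + t *: w).
  rewrite mulmxDl -scalemxAl !dotrDl !dotrDr !dotrZl !dotrZr Tc0.
  rewrite (_ : dotr (w *m T) c = b); last by rewrite dotr_mulmx symT.
  rewrite -/w -/b -/q; set lhs := (X in 0 <= X).
  by rewrite (_ : lhs = 2 * t * b + t ^+ 2 * q) // /lhs; ring.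
have q1 : 0 < q + 1 by lra.
(* The minimizer in [t] is [- b / q]; the shifted denominator covers [q = 0]. *)
have := shift (- (b / (q + 1))).
rewrite (_ : _ + _ = - (b ^+ 2 * ((q + 2) / (q + 1) ^+ 2))); last first.
  by field; rewrite gt_eqF.
have pos : 0 < (q + 2) / (q + 1) ^+ 2 by rewrite divr_gt0 ?exprn_gt0 //; lra.
rewrite oppr_ge0 pmulr_lle0 // => b2.
by apply/eqP; rewrite -sqrf_eq0 eq_le b2 sqr_ge0.
Qed.

(** The maximum [mu] of the quadratic form on the unit sphere is an eigenvalue:
    [mu%:M - S] is positive semidefinite and isotropic at a maximizer. *)
Lemma symmetric_top_eigenvalue (S : 'M[R]_n) :
  (0 < n)%N -> S^T = S ->
  exists2 mu, eigenvalue S mu &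
    forall v, dotr (v *m S) v <= mu * dotr v v.
Proof.
move=> n_gt0 symS.
have sphere0 : [set v : 'rV[R]_n | dotr v v = 1] !=set0.
  exists (delta_mx 0 (Ordinal n_gt0)) => /=.
  by rewrite /dotr trmx_delta mul_delta_mx mxE !eqxx.
have [|c] := EVT_max_rV sphere0 compact_unit_sphere
  (f := fun v => dotr (v *m S) v).
  exact/continuous_subspaceT/continuous_quadratic_form.
rewrite inE /= => c1 cmax; set mu := dotr (c *m S) c in cmax.
have mu_max v : dotr (v *m S) v <= mu * dotr v v.
  have [->|v0] := eqVneq v 0.
    by rewrite mul0mx /dotr !mul0mx mxE mulr0.
  have vv := dotrr_gt0 v0.
  set a := (Num.sqrt (dotr v v))^-1.
  have a2 : a ^+ 2 = (dotr v v)^-1 by rewrite exprVn sqr_sqrtr // ltW.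
  have := cmax (a *: v).
  rewrite inE /= -scalemxAl !dotrZl !dotrZr !mulrA -!expr2 a2.
  rewrite mulVf ?gt_eqF // => /(_ erefl).
  by rewrite mulrC ler_pdivrMr.
exists mu => //; apply/eigenvalueP; exists c; last first.
  apply/eqP => c0; move: c1; rewrite c0 /dotr mul0mx mxE => /esym/eqP.
  by rewrite oner_eq0.
have gapE v : dotr (v *m (mu%:M - S)) v = mu * dotr v v - dotr (v *m S) v.
  by rewrite /dotr mulmxBr mulmxBl mul_mx_scalar -scalemxAl !mxE.
suff : c *m (mu%:M - S) = 0.
  by rewrite mulmxBr mul_mx_scalar => /eqP; rewrite subr_eq0 => /eqP.
apply: psd_isotropic_kernel => [|v|].
- by rewrite linearB /= tr_scalar_mx symS.
- by rewrite gapE subr_ge0.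
- by rewrite gapE c1 mulr1 subrr.
Qed.

End SymmetricEigenvalue.

(** * The largest singular value as an operator norm *)

Section SigmaMax.
Variables (R : realType) (m n : nat).
Implicit Types M N : 'M[R]_(m, n).

Lemma singular_vector_exists M (s : R) : singular_value M s ->
  0 <= s /\ exists2 v : 'rV[R]_n, v != 0 &
    dotr (v *m M^T) (v *m M^T) = s ^+ 2 * dotr v v.
Proof.
case=> s_ge0 /eigenvalueP[v vE v0]; split=> //; exists v => //.
by rewrite -dotr_mulmx -mulmxA vE dotrZl.
Qed.

Hypothesis n_gt0 : (0 < n)%N.

(** The square root of the top eigenvalue of [M^T *m M] is a singular value and
    bounds every other one, so the supremum is attained there, and the bound on
    the quadratic form of [M^T *m M] becomes the operator norm bound. *)
Lemma sigma_maxP M : singular_value M (sigma_max M) /\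
  forall v : 'rV[R]_n,
    dotr (v *m M^T) (v *m M^T) <= sigma_max M ^+ 2 * dotr v v.
Proof.
have symMM : (M^T *m M)^T = M^T *m M by rewrite trmx_mul trmxK.
have [mu mu_eig mu_max] := symmetric_top_eigenvalue n_gt0 symMM.
have normE (v : 'rV[R]_n) :
    dotr (v *m (M^T *m M)) v = dotr (v *m M^T) (v *m M^T).
  by rewrite mulmxA dotr_mulmx.
have mu_ge0 : 0 <= mu.
  have /eigenvalueP[v vE v0] := mu_eig.
  have := dotrr_ge0 (v *m M^T).
  by rewrite -normE vE dotrZl pmulr_lge0 // dotrr_gt0.
have sing : singular_value M (Num.sqrt mu).
  by split; rewrite ?sqrtr_ge0 // sqr_sqrtr.
have ub : ubound (fun s : R => singular_value M s) (Num.sqrt mu).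
  move=> s /singular_vector_exists[s_ge0 [v v0 vE]].
  have := mu_max v; rewrite normE vE ler_pM2r ?dotrr_gt0 // => s2.
  by rewrite -(ger0_norm s_ge0) -sqrtr_sqr ler_wsqrtr.
have -> : sigma_max M = Num.sqrt mu.
  apply/eqP; rewrite eq_le /sigma_max ge_sup //=; last by exists (Num.sqrt mu).
  by rewrite ub_le_sup //; exists (Num.sqrt mu).
by split=> // v; rewrite sqr_sqrtr // -normE.
Qed.

Lemma sigma_max_gt0 M : M != 0 -> 0 < sigma_max M.
Proof.
have [[s_ge0 _] bound] := sigma_maxP M.
rewrite lt_neqAle s_ge0 andbT; apply: contra => /eqP s0.
rewrite -(inj_eq trmx_inj) trmx0; apply/eqP/row_matrixP => i; rewrite row0 rowE.
apply: dotrr_eq0; apply/eqP; rewrite eq_le dotrr_ge0 andbT.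
by rewrite (le_trans (bound _)) // -s0 expr0n mul0r.
Qed.

(** If [v] is a top right singular vector of [N], then [`|v|] has the same norm
    and [`|N v| <= rho * M `|v|] in each coordinate. *)
Lemma sigma_max_le_scale N M (rho : R) : 0 <= rho ->
  (forall i j, `|N i j| <= rho * M i j) ->
  sigma_max N <= rho * sigma_max M.
Proof.
move=> rho_ge0 NM.
have [[sM_ge0 _] boundM] := sigma_maxP M.
have [/singular_vector_exists[sN_ge0 [v v0 vE]] _] := sigma_maxP N.
set w := map_mx Num.norm v.
have domin : dotr (v *m N^T) (v *m N^T) <=
    dotr (rho *: (w *m M^T)) (rho *: (w *m M^T)).
  apply: dotrr_le => i; rewrite !mxE mulr_sumr.
  apply: le_trans (ler_norm_sum _ _ _) _; apply: ler_sum => j _.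
  by rewrite !mxE normrM mulrCA ler_wpM2l.
rewrite -(@ler_pXn2r _ 2) ?nnegrE ?mulr_ge0 //.
rewrite -(ler_pM2r (dotrr_gt0 v0)) -vE (le_trans domin) //.
rewrite dotrZl dotrZr mulrA -expr2 exprMn -[leRHS]mulrA ler_wpM2l ?exprn_ge0 //.
by rewrite -(dotrr_abs v).
Qed.

End SigmaMax.

(** * Reactances and control slopes *)

Section Reactance.
Variables (R : realType) (n : nat) (L : {set {set 'I_n.+1}}).
Variable x : {set 'I_n.+1} -> R.
Hypothesis x_gt0 : forall l, l \in L -> 0 < x l.

Lemma reactance_mx_ge0 i j : 0 <= reactance_mx L x i j.
Proof.
rewrite mxE; apply: sumr_ge0 => l; rewrite !inE => /andP[/andP[lL _] _].
exact/ltW/x_gt0.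
Qed.

(** The path from the root to [i] has at least one line, as [i] is not the
    root. *)
Lemma reactance_mx_diag_gt0 i : is_tree L -> 0 < reactance_mx L x i i.
Proof.
case=> _ /(_ ord0 (lift ord0 i)) [p [p_path _]].
have [l l_root] : exists l, l \in root_lines L i.
  case: p p_path => [[_ /= /eqP]|k p p_path]; first by rewrite eq_sym.
  exists [set ord0; k]%SET; rewrite inE.
  have [/= /andP[lL _] _ _] := p_path.
  apply/andP; split=> //; apply/asboolP; exists (k :: p).
  by split=> //; rewrite /= mem_head.
rewrite mxE finset.setIid (bigD1 l) //= ltr_wpDr //; last first.
  by apply: x_gt0; move: l_root; rewrite inE => /andP[].
apply: sumr_ge0 => k /andP[]; rewrite inE => /andP[kL _] _.
exact/ltW/x_gt0.
Qed.

End Reactance.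

(** A slope bound [0] would make [f] constant beyond the deadband, by the mean
    value theorem. *)
Lemma slope_bound_gt0 (R : realType) (delta alpha : R) (f : R -> R) :
  control_function delta f ->
  (forall u : R, derivable f u 1 -> `|derive1 f u| <= alpha) -> 0 < alpha.
Proof.
case=> _ _ decr der bound; rewrite ltNge; apply/negP => alpha_le0.
pose a := delta / 2 + 1; pose b := delta / 2 + 2.
have out u : a <= u -> outside_deadband delta u by rewrite /a; right; lra.
have ab : a < b by rewrite /a /b; lra.
have df0 u : a <= u -> is_derive u 1 f 0.
  move=> /out/der du; apply: DeriveDef => //; rewrite -derive1E.
  by apply/eqP; rewrite -normr_le0 (le_trans (bound _ du)).
have [||c _ fab] := @MVT R f (fun=> 0) a b ab.
- by move=> u; rewrite in_itv /= => /andP[/ltW /df0].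
- apply: derivable_within_continuous => u; rewrite in_itv /= => /andP[au _].
  exact/der/out.
have := decr a b (out _ (lexx _)) (out _ (ltW ab)) ab.
by rewrite -subr_lt0 fab mul0r ltxx.
Qed.

Theorem theorem5 (R : realType) (n : nat) (hn : (0 < n)%N)
    (L : {set {set 'I_n.+1}}) (x : {set 'I_n.+1} -> R)
    (delta alpha : 'I_n -> R) (f : 'I_n -> R -> R)
    (hL : is_tree L)
    (hx : forall l, l \in L -> 0 < x l)
    (hdelta : forall i, 0 <= delta i)
    (hf : forall i, control_function (delta i) (f i))
    (halpha : forall i (u : R), derivable (f i) u 1 ->
                `|derive1 (f i) u| <= alpha i) :
  let X := reactance_mx L x in
  let Xbar := zero_diag X in
  let A := diag_mx (\row_(i < n) alpha i) in
  let B := diag_mx (\row_(i < n) (1 / (1 / alpha i + 2 * X i i))) in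
  sigma_max (B *m Xbar) < sigma_max (A *m X).
Proof.
cbv zeta; set X := reactance_mx L x; set Xbar := zero_diag X.
set A := diag_mx (\row_i alpha i); set B := diag_mx _.
have alpha_gt0 i : 0 < alpha i := slope_bound_gt0 (hf i) (halpha i).
have Xii_gt0 i : 0 < X i i := reactance_mx_diag_gt0 hx i hL.
have X_ge0 i j : 0 <= X i j := reactance_mx_ge0 hx i j.
have AXE i j : (A *m X) i j = alpha i * X i j by rewrite mul_diag_mx !mxE.
have AX_ge0 i j : 0 <= (A *m X) i j by rewrite AXE mulr_ge0 // ltW.
pose c i := 1 / (1 + 2 * alpha i * X i i).
have den_gt1 i : 1 < 1 + 2 * alpha i * X i i by rewrite ltrDl !mulr_gt0.
have betaE i : 1 / (1 / alpha i + 2 * X i i) = c i * alpha i.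
  have den1 := den_gt1 i.
  by rewrite /c; field; rewrite (gt_eqF (alpha_gt0 i)) gt_eqF //; lra.
have c_gt0 i : 0 < c i by rewrite divr_gt0 // (lt_trans _ (den_gt1 i)).
pose rho := \big[Num.max/0]_i c i.
have rho_ge0 : 0 <= rho by exact: bigmax_ge_id.
have rho_lt1 : rho < 1.
  apply: bigmax_lt => // i _; have den1 := den_gt1 i.
  by rewrite /c ltr_pdivrMr; lra.
have AX_neq0 : A *m X != 0.
  pose i := Ordinal hn; apply/eqP => /matrixP/(_ i i)/eqP.
  by rewrite AXE [eqbRHS]mxE gt_eqF // mulr_gt0.
apply: (@le_lt_trans _ _ (rho * sigma_max (A *m X))); last first.
  by rewrite gtr_pMl // sigma_max_gt0.
have BXE i j : (B *m Xbar) i j = if i == j then 0 else c i * (A *m X) i j.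
  rewrite mul_diag_mx AXE mulrA -betaE [in LHS]mxE [X in X * _]mxE.
  by rewrite [Xbar _ _]mxE; case: eqP; rewrite ?mulr0.
apply: sigma_max_le_scale => // i j; rewrite BXE.
case: eqP => _; first by rewrite normr0 mulr_ge0.
rewrite ger0_norm; last by rewrite mulr_ge0 // ltW.
by rewrite ler_wpM2r // /rho le_bigmax.
Qed.
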